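(* Let $q:\mathsf D\to\mathbb R$ be a query with sensitivity $\Delta q$, and let $b>0$ be a random scale parameter such that $1/b$ has moment generating function $M_{1/b}(t)=\mathbb E[e^{t/b}]$. Then the R$^2$DP Laplace mechanism $\mathcal M_q(d,b)=q(d)+\mathrm{Lap}(b)$ is $$\ln\left[\frac{\mathbb E(1/b)}{\frac{d M_{1/b}(t)}{dt}\big|_{t=-\Delta q}}\right]\text{-differentially private.}$$
   Context: $\mathrm{Lap}(b)$ is the zero-mean Laplace distribution with density $\frac{1}{2b}e^{-|x|/b}$. In the R$^2$DP Laplace mechanism the scale $b$ is itself random (drawn from a fixed distribution on $(0,\infty)$, independently of the data) and, conditionally on $b$, noise $\mathrm{Lap}(b)$ is added to $q(d)$. Two datasets $d,d'$ are adjacent if one is obtained from the other by adding or removing the data of one individual; the sensitivity is $\Delta q=\max_{d,d'\text{ adjacent}}|q(d)-q(d')|$. A randomized mechanism $\mathcal M$ is $\epsilon$-differentially private if $\mathbb P(\mathcal M(d)\in S)\le e^{\epsilon}\mathbb P(\mathcal M(d')\in S)$ for all adjacent $d,d'$ and all measurable $S$. Here $\frac{dM_{1/b}}{dt}(t)=\mathbb E[\frac1b e^{t/b}]$. *)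

(* Defs.v *)
From HB Require Import structures.
From mathcomp Require Import all_boot all_order all_algebra.
From mathcomp Require Import all_classical all_reals all_analysis.
Set Implicit Arguments. Unset Strict Implicit. Unset Printing Implicit Defensive.
Import Order.TTheory GRing.Theory Num.Theory.
Import numFieldNormedType.Exports.
Local Open Scope classical_set_scope.
Local Open Scope ring_scope.

(* Datasets: finite multisets of records of type T, represented by sequences
   (considered up to permutation). d and d' are adjacent if one is obtained
   from the other by adding the data of one individual. *)
Definition adjacent (T : eqType) (d d' : seq T) : Prop :=
  (exists x, perm_eq d' (x :: d)) \/ (exists x, perm_eq d (x :: d')).

Definition is_sensitivity (T : eqType) (R : realType) (q : seq T -> R) (dq : R)
  : Prop :=
  (forall d d', adjacent d d' -> `|q d - q d'| <= dq) /\
  (exists d d', adjacent d d' /\ `|q d - q d'| = dq).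

Definition laplace_pdf (R : realType) (b mu x : R) : R :=
  (2 * b)^-1 * expR (- `|x - mu| / b).

(* R^2DP Laplace mechanism: the scale b has distribution P (a probability
   measure on R concentrated on (0,oo)); conditionally on b, Lap(b) noise is
   added to q d.  mech_prob P q d S = P(M_q(d,b) \in S). *)
Definition mech_prob (T : eqType) (R : realType) (P : probability R R)
  (q : seq T -> R) (d : seq T) (S : set R) : \bar R :=
  \int[P]_(b in setT)
     (\int[lebesgue_measure]_(x in S) (laplace_pdf b (q d) x)%:E).

Definition mean_inv (R : realType) (P : probability R R) : \bar R :=
  \int[P]_(b in setT) (b^-1)%:E.

(* dM_{1/b}/dt (t) = E[(1/b) e^{t/b}] *)
Definition dMGF_inv (R : realType) (P : probability R R) (t : R) : \bar R :=
  \int[P]_(b in setT) (b^-1 * expR (t / b))%:E.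

Definition differentially_private (T : eqType) (R : realType)
  (P : probability R R) (q : seq T -> R) (eps : R) : Prop :=
  forall d d' (S : set R), adjacent d d' -> measurable S ->
    (mech_prob P q d S <= (expR eps)%:E * mech_prob P q d' S)%E.

(* Main.v *)
(** Write [G t = E[(1/b) e^(-t/b)]], so that [G 0 = E(1/b)] and [G dq] is the
    derivative of the moment generating function at [- dq]. By Tonelli the
    output of the mechanism on [d] has density [G |x - q d| / 2]. Since [G] is
    nonincreasing and [|x - q d'| <= |x - q d| + dq], it is enough to compare
    [G s] with [G (s + dq)]; and [G s * G dq <= G 0 * G (s + dq)] is
    Chebyshev's association inequality for the weight [1/b] and the functions
    [e^(-s/b)] and [e^(-dq/b)], both nondecreasing in [b]. *)
Require Import Defs.
From HB Require Import structures.
From mathcomp Require Import all_boot all_order all_algebra.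
From mathcomp Require Import all_classical all_reals all_analysis.
From mathcomp Require Import measurable_realfun ring.
Import Order.TTheory GRing.Theory Num.Theory.
Import numFieldNormedType.Exports.
Local Open Scope classical_set_scope.
Local Open Scope ring_scope.

(** * Integrals over sets of full measure and over rectangles *)

Lemma integral_full_measure {d : measure_display} {T : measurableType d}
    {R : realType} {mu : {measure set T -> \bar R}} {D : set T}
    (f : T -> \bar R) :
  measurable D -> mu (~` D) = 0%E -> measurable_fun setT f ->
  (\int[mu]_x f x = \int[mu]_(x in D) f x)%E.
Proof.
move=> mD D0 mf; rewrite [RHS]integral_mkcond.
apply: ae_eq_integral => //.
  by apply/(measurable_restrictT _ _).1 => //; exact: measurable_funTS.
exists (~` D); split => //; first exact: measurableC.
move=> x /=; apply: contra_not => Dx _.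
by rewrite /patch mem_set.
Qed.

(** Tonelli applies to the positive and negative parts separately. No sign is imposed on [f] because
    [laplace_pdf] is negative for a negative scale. *)
Lemma measurable_fun_integral_prod {d1 d2 : measure_display}
    {T1 : measurableType d1} {T2 : measurableType d2} {R : realType}
    (m2 : {sigma_finite_measure set T2 -> \bar R}) {B : set T2}
    {f : T1 * T2 -> \bar R} :
  measurable B -> measurable_fun setT f ->
  measurable_fun setT (fun x => \int[m2]_(y in B) f (x, y))%E.
Proof.
move=> mB mf.
pose g := f \_ (setT `*` B).
have mg : measurable_fun setT g.
  apply/(measurable_restrictT _ _).1; first exact: measurableX.
  exact: measurable_funTS.
have -> : (fun x => \int[m2]_(y in B) f (x, y))%E =
  (fun x => \int[m2]_y (g^\+)%E (x, y) - \int[m2]_y (g^\-)%E (x, y))%E.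
  apply/funext => x; rewrite integral_mkcond.
  rewrite (eq_integral (fun y => g (x, y))) => [|y _]; last first.
    by rewrite /g /patch in_setX in_setT.
  by rewrite integralE; congr (_ - _)%E; apply: eq_integral => y _;
    rewrite ?funeposE ?funenegE.
apply: emeasurable_funB.
- apply: (measurable_fun_fubini_tonelli_F (m2 := m2) (g^\+)%E).
    exact: measurable_funepos.
  by move=> z; exact: funepos_ge0.
- apply: (measurable_fun_fubini_tonelli_F (m2 := m2) (g^\-)%E).
    exact: measurable_funeneg.
  by move=> z; exact: funeneg_ge0.
Qed.

(** Extending [f] by zero outside [A]*[B] makes it nonnegative everywhere, which reduces the claim
    to Tonelli on the whole product. *)
Lemma fubini_tonelli_setX {d1 d2 : measure_display}
    {T1 : measurableType d1} {T2 : measurableType d2} {R : realType}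
    (m1 : {sigma_finite_measure set T1 -> \bar R})
    (m2 : {sigma_finite_measure set T2 -> \bar R}) {A : set T1} {B : set T2}
    {f : T1 * T2 -> \bar R} :
  measurable A -> measurable B -> measurable_fun setT f ->
  (forall x y, A x -> B y -> 0 <= f (x, y))%E ->
  (\int[m1]_(x in A) \int[m2]_(y in B) f (x, y) =
   \int[m2]_(y in B) \int[m1]_(x in A) f (x, y))%E.
Proof.
move=> mA mB mf f0.
pose g := f \_ (A `*` B).
have mg : measurable_fun setT g.
  apply/(measurable_restrictT _ _).1; first exact: measurableX.
  exact: measurable_funTS.
have g0 z : (0 <= g z)%E.
  rewrite /g /patch; case: ifPn => // /set_mem; case: z => x y [] /=.
  exact: f0.
transitivity (\int[m1]_x \int[m2]_y g (x, y))%E.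
  rewrite integral_mkcond; apply: eq_integral => x _.
  rewrite /patch; case: ifPn => xA.
    rewrite integral_mkcond; apply: eq_integral => y _.
    by rewrite /g /patch in_setX xA.
  rewrite [RHS]integral0_eq// => y _.
  by rewrite /g /patch in_setX (negbTE xA).
rewrite fubini_tonelli//.
rewrite [RHS]integral_mkcond; apply: eq_integral => y _.
rewrite /patch; case: ifPn => yB.
  rewrite [RHS]integral_mkcond; apply: eq_integral => x _.
  by rewrite /g /patch in_setX yB andbT.
rewrite integral0_eq// => x _.
by rewrite /g /patch in_setX (negbTE yB) andbF.
Qed.

Lemma measurable_laplace_pdf {R : realType} (mu : R) :
  measurable_fun [set: R] (GRing.inv : R -> R) ->
  measurable_fun setT (fun z : R * R => laplace_pdf z.1 mu z.2).
Proof.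
move=> minv; rewrite /laplace_pdf.
apply: measurable_funM.
  under eq_fun do rewrite invfM.
  apply: measurable_funM => //.
  exact: (measurableT_comp minv).
apply: measurableT_comp => //.
apply: measurable_funM; last exact: (measurableT_comp minv).
apply: measurableT_comp => //; apply: measurableT_comp => //.
exact: measurable_funB.
Qed.

(** * Weighted integrals of decaying exponentials *)

Lemma integrable_mul_expRN {d : measure_display} {T : measurableType d}
    {R : realType} {mu : {measure set T -> \bar R}} {D : set T} {w phi : T -> R}
    {s : R} :
  measurable D -> 0 <= s -> (forall x, D x -> 0 <= phi x) ->
  measurable_fun D phi -> mu.-integrable D (EFin \o w) ->
  mu.-integrable D (EFin \o (fun x => w x * expR (- s * phi x))).
Proof.
move=> mD s0 phi0 mphi iw.
apply: (le_integrable mD _ _ iw).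
- apply/measurable_EFinP; apply: measurable_funM.
    exact/measurable_EFinP/(measurable_int mu).
  by apply: measurableT_comp => //; exact: measurable_funM.
- move=> x Dx /=; rewrite lee_fin normrM ler_piMr//.
  by rewrite ger0_norm ?expR_ge0// expR_le1 mulNr oppr_le0 mulr_ge0// phi0.
Qed.

(** If the integral vanished, [f] would be zero almost everywhere on [D], so [D] would lie in a null
    set. *)
Lemma Rintegral_gt0 {d : measure_display} {T : measurableType d}
    {R : realType} {mu : {measure set T -> \bar R}} {D : set T} {f : T -> R} :
  measurable D -> (0 < mu D)%E -> mu.-integrable D (EFin \o f) ->
  (forall x, D x -> 0 < f x) -> 0 < \int[mu]_(x in D) f x.
Proof.
move=> mD muD fint f0.
have f_ge0 x : D x -> (0 <= (f x)%:E)%E by move=> Dx; rewrite lee_fin ltW// f0.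
rewrite lt_neqAle Rintegral_ge0 ?andbT; last by move=> x /f0/ltW.
rewrite eq_sym; apply/eqP => int0.
have abs0 : (\int[mu]_(x in D) `|(f x)%:E|)%E = 0%E.
  rewrite -[RHS]/(0%:E) -int0 fineK; last exact: integrable_fin_num.
  by apply: eq_integral => x; rewrite inE => Dx; rewrite gee0_abs// f_ge0.
have mf := measurable_int mu fint.
have [N [mN N0 DN]] := (ae_eq_integral_abs mu mD mf).1 abs0.
have : (mu D <= mu N)%E.
  apply: le_measure; rewrite ?inE// => x Dx; apply: DN => /= /(_ Dx) [fx0].
  by have := f0 x Dx; rewrite fx0 ltxx.
by rewrite N0 leNgt muD.
Qed.

(* Chebyshev's association inequality. The mean of [expR (- t * phi)] under the
   weight [w] has the form [expR (- t * u)], and then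
   [(expR (- t * phi) - expR (- t * u)) * (expR (- s * phi) - expR (- s * u))]
   is nonnegative, both factors having the sign of [u - phi]. *)
Lemma Rintegral_expRN_supmul {d : measure_display} {T : measurableType d}
    {R : realType} {mu : {measure set T -> \bar R}} {D : set T} {w phi : T -> R}
    {s t : R} :
  measurable D -> 0 <= s -> 0 <= t ->
  (forall x, D x -> 0 <= w x) -> (forall x, D x -> 0 <= phi x) ->
  measurable_fun D phi -> mu.-integrable D (EFin \o w) ->
  (\int[mu]_(x in D) (w x * expR (- s * phi x))) *
  (\int[mu]_(x in D) (w x * expR (- t * phi x))) <=
  (\int[mu]_(x in D) w x) *
  (\int[mu]_(x in D) (w x * expR (- (s + t) * phi x))).
Proof.
move=> mD s0 t0 w0 phi0 mphi iw.
have iG (r : R) : 0 <= r ->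
    mu.-integrable D (EFin \o (fun x => w x * expR (- r * phi x))).
  by move=> r0; exact: integrable_mul_expRN.
pose G r := \int[mu]_(x in D) (w x * expR (- r * phi x)).
rewrite -/(G s) -/(G t) -/(G (s + t)); set B := \int[mu]_(x in D) w x.
have G0 r : 0 <= G r.
  by apply: Rintegral_ge0 => x Dx; rewrite mulr_ge0 ?w0 ?expR_ge0.
have B0 : 0 <= B by exact: Rintegral_ge0.
(* The witness [u] divides by [t] and takes the logarithm of [G t / B], so the cases [t = 0] and
   [G t = 0] are settled first. *)
have [->|t_neq0] := eqVneq t 0.
  have -> : G 0 = B.
    by apply: eq_Rintegral => x _; rewrite oppr0 mul0r expR0 mulr1.
  by rewrite addr0 mulrC.
have [->|Gt_neq0] := eqVneq (G t) 0; first by rewrite mulr0 mulr_ge0.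
have Gt_gt0 : 0 < G t by rewrite lt_neqAle eq_sym Gt_neq0 G0.
have GtB : G t <= B.
  apply: le_Rintegral => //; first exact: iG.
  move=> x Dx; rewrite ler_piMr ?w0// expR_le1 mulNr oppr_le0 mulr_ge0//.
  exact: phi0.
have B_gt0 : 0 < B by exact: lt_le_trans GtB.
pose m := G t / B.
pose u := - ln m / t.
pose c := expR (- s * u).
have mE : expR (- t * u) = m.
  rewrite /u mulNr mulrCA divff// mulr1 opprK lnK// posrE divr_gt0//.
have pw x : 0 <= (expR (- t * phi x) - m) * (expR (- s * phi x) - c).
  rewrite -mE /c; have [pu|pu] := leP (phi x) u.
    by rewrite mulr_ge0// subr_ge0 ler_expR ler_wnM2l// oppr_le0.
  by rewrite mulr_le0// subr_le0 ler_expR ler_wnM2l ?oppr_le0// ltW.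
(* This is the integral of [w] times the product in [pw], expanded by linearity. *)
have key : 0 <= (G (s + t) - m * G s) - c * (G t - m * B).
  have iZ (r k : R) : 0 <= r -> mu.-integrable D
      (EFin \o (fun x => k * (w x * expR (- r * phi x)))).
    by move=> r0; apply: (integrableZl mD k (iG _ r0)).
  have iZw k : mu.-integrable D (EFin \o (fun x => k * w x)).
    exact: (integrableZl mD k iw).
  rewrite -(RintegralZl m mD (iG _ s0)) -(RintegralZl m mD iw).
  have st0 : 0 <= s + t by exact: addr_ge0.
  rewrite -(RintegralB mD (iG _ st0) (iZ s m s0)).
  rewrite -(RintegralB mD (iG _ t0) (iZw m)).
  have i1 : mu.-integrable D (EFin \o (fun x =>
      w x * expR (- (s + t) * phi x) - m * (w x * expR (- s * phi x)))).
    exact: (integrableB mD (iG _ st0) (iZ s m s0)).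
  have i2 : mu.-integrable D (EFin \o (fun x =>
      w x * expR (- t * phi x) - m * w x)).
    exact: (integrableB mD (iG _ t0) (iZw m)).
  rewrite -RintegralZl// -RintegralB//; last exact: (integrableZl mD c i2).
  apply: Rintegral_ge0 => x Dx.
  have -> : w x * expR (- (s + t) * phi x) - m * (w x * expR (- s * phi x)) -
      c * (w x * expR (- t * phi x) - m * w x) =
      w x * ((expR (- t * phi x) - m) * (expR (- s * phi x) - c)).
    rewrite opprD mulrDl expRD; ring.
  by rewrite mulr_ge0 ?w0.
(* Since [m] is the mean [G t / B], the term with factor [c] vanishes. *)
move: key; rewrite /m divfK ?gt_eqF// subrr mulr0 subr0 subr_ge0.
by rewrite mulrAC ler_pdivrMr// mulrC [X in _ <= X]mulrC.
Qed.

(** * The mixture of Laplace densities over the random scale *)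

(** The function [G] of the overview, as a real number. Integrating over positive scales only keeps
    [b^-1] nonnegative, as the association inequality requires. *)
Definition invexp_mean {R : realType} (P : probability R R) (t : R) : R :=
  \int[P]_(b in `]0, +oo[%classic) (b^-1 * expR (- t * b^-1)).

Section mixture.
Context {R : realType} (P : probability R R).
Hypothesis P1 : P `]0, +oo[%classic = 1%E.
Hypothesis Pint : P.-integrable setT (fun b => (b^-1)%:E).

Let D : set R := `]0, +oo[%classic.

Let mD : measurable D. Proof. exact: measurable_itv. Qed.

Let PD0 : P (~` D) = 0%E.
Proof. by rewrite probability_setC// P1 subee. Qed.

Let PD_gt0 : (0 < P D)%E.
Proof. by rewrite P1. Qed.

Let D_gt0 (b : R) : D b -> 0 < b.
Proof. by rewrite /D /= in_itv/= andbT. Qed.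

Let minv : measurable_fun [set: R] (GRing.inv : R -> R).
(* Measurability of inversion is part of the integrability of [1/b]. *)
Proof. by apply/measurable_EFinP; exact: measurable_int Pint. Qed.

Let inv_ge0 (b : R) : D b -> 0 <= b^-1.
Proof. by move=> /D_gt0 b0; rewrite invr_ge0 ltW. Qed.

Let iinv : P.-integrable D (EFin \o GRing.inv).
Proof. exact: integrableS Pint. Qed.

Let imean (t : R) : 0 <= t ->
  P.-integrable D (EFin \o (fun b : R => b^-1 * expR (- t * b^-1))).
Proof.
move=> t0; apply: integrable_mul_expRN => //.
exact: measurable_funTS.
Qed.

Lemma invexp_mean_gt0 (t : R) : 0 <= t -> 0 < invexp_mean P t.
Proof.
move=> t0; apply: (Rintegral_gt0 mD PD_gt0 (imean t t0)).
by move=> b /D_gt0 b0; rewrite mulr_gt0 ?invr_gt0 ?expR_gt0.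
Qed.

Lemma fine_mean_invE : fine (mean_inv P) = invexp_mean P 0.
Proof.
rewrite /mean_inv (integral_full_measure _ mD PD0); last exact/measurable_EFinP.
by apply: eq_Rintegral => b _; rewrite oppr0 mul0r expR0 mulr1.
Qed.

Lemma fine_dMGF_invE (t : R) : fine (dMGF_inv P (- t)) = invexp_mean P t.
Proof.
rewrite /dMGF_inv (integral_full_measure _ mD PD0)//.
apply/measurable_EFinP; apply: measurable_funM => //.
by apply: measurableT_comp => //; exact: measurable_funM.
Qed.

(** The association inequality bounds [G s * G t] by [G 0 * G (s + t)], and [G (s + t) <= G r]
    because [G] is nonincreasing. *)
Lemma invexp_mean_ratio (s r t : R) :
  0 <= s -> 0 <= t -> 0 <= r -> r <= s + t ->
  invexp_mean P s <=
    invexp_mean P 0 / invexp_mean P t * invexp_mean P r.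
Proof.
move=> s0 t0 r0 rst; rewrite mulrAC ler_pdivlMr ?invexp_mean_gt0//.
apply: le_trans (Rintegral_expRN_supmul mD s0 t0 inv_ge0 inv_ge0 _ iinv) _.
  exact: measurable_funTS.
have -> : \int[P]_(b in D) b^-1 = invexp_mean P 0.
  by apply: eq_Rintegral => b _; rewrite oppr0 mul0r expR0 mulr1.
rewrite ler_wpM2l ?(ltW (invexp_mean_gt0 _ _))//.
apply: (le_Rintegral mD (imean (s + t) (addr_ge0 s0 t0)) (imean r r0)) => b Db.
by rewrite ler_wpM2l ?inv_ge0// ler_expR ler_wpM2r ?inv_ge0// lerN2.
Qed.

Lemma integral_laplace_pdf (mu x : R) :
  (\int[P]_(b in D) (laplace_pdf b mu x)%:E)%E =
  (2^-1 * invexp_mean P `|x - mu|)%:E.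
Proof.
have ix := imean `|x - mu| (normr_ge0 _).
rewrite -(RintegralZl 2^-1 mD ix) fineK.
  by apply: eq_integral => b _; rewrite /laplace_pdf invfM mulrA mulNr.
exact: (integrable_fin_num mD (integrableZl mD 2^-1 ix)).
Qed.

Lemma mech_prob_density (T : eqType) (q : seq T -> R) (d : seq T) (S : set R) :
  measurable S ->
  mech_prob P q d S =
  (\int[lebesgue_measure]_(x in S) (2^-1 * invexp_mean P `|x - q d|)%:E)%E.
Proof.
move=> mS; pose f (z : R * R) := (laplace_pdf z.1 (q d) z.2)%:E.
have mf : measurable_fun setT f.
  by apply/measurable_EFinP; exact: measurable_laplace_pdf.
(* Restricting to positive scales comes before the exchange of integrals, since only there is the
   integrand nonnegative. *)
rewrite /mech_prob (integral_full_measure _ mD PD0); last first.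
  exact: (measurable_fun_integral_prod lebesgue_measure mS mf).
rewrite (fubini_tonelli_setX P lebesgue_measure mD mS mf); last first.
  move=> b x /D_gt0 b0 _; rewrite lee_fin mulr_ge0 ?expR_ge0//.
  by rewrite invr_ge0 mulr_ge0// ltW.
by apply: eq_integral => x _; rewrite -integral_laplace_pdf.
Qed.

Lemma measurable_invexp_mean (mu : R) :
  measurable_fun [set: R] (fun x => invexp_mean P `|x - mu|).
Proof.
pose f (z : R * R) := (laplace_pdf z.2 mu z.1)%:E.
have mf : measurable_fun setT f.
  apply/measurable_EFinP.
  (* The coordinates are swapped so that integrating out the scale leaves a function of [x]. *)
  exact: (measurableT_comp (measurable_laplace_pdf mu minv)
    (@measurable_swap _ _ R R)).
have := measurable_fun_integral_prod P mD mf.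
under eq_fun do rewrite integral_laplace_pdf.
move=> /measurable_EFinP mhalf.
have -> : (fun x => invexp_mean P `|x - mu|) =
    (fun x => 2 * (2^-1 * invexp_mean P `|x - mu|)).
  by apply/funext => x; rewrite mulVKf.
exact: measurable_funM.
Qed.

End mixture.

Theorem theorem4p1 (R : realType) (T : eqType) (q : seq T -> R) (dq : R)
  (P : probability R R) :
  is_sensitivity q dq ->
  P `]0, +oo[%classic = 1%E ->
  P.-integrable setT (fun b => (b^-1)%:E) ->
  differentially_private P q
    (ln (fine (mean_inv P) / fine (dMGF_inv P (- dq)))).
Proof.
move=> [q_le [d0 [d1 [_ dqE]]]] P1 Pint d d' S dd' mS.
(* The sensitivity is attained, hence equal to an absolute value. *)
have dq0 : 0 <= dq by rewrite -dqE.
rewrite fine_mean_invE// fine_dMGF_invE// lnK; last first.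
  by rewrite posrE divr_gt0 ?invexp_mean_gt0.
have mdens e : measurable_fun S
    (fun x => (2^-1 * invexp_mean P `|x - q e|)%:E).
  apply: measurable_funTS; apply/measurable_EFinP; apply: measurable_funM => //.
  exact: measurable_invexp_mean.
have dens_ge0 e x : (0 <= (2^-1 * invexp_mean P `|x - q e|)%:E)%E.
  by rewrite lee_fin mulr_ge0// ltW// invexp_mean_gt0.
rewrite !mech_prob_density// -ge0_integralZl//; [|exact: mdens|]; last first.
  by rewrite lee_fin divr_ge0 ?ltW ?invexp_mean_gt0.
apply: ge0_le_integral => //; [exact: mdens| |].
  by apply: measurable_funeM; exact: mdens.
(* The densities are compared pointwise, with [s = |x - q d|], [r = |x - q d'|] and [t = dq]; the
   triangle inequality gives [r <= s + t]. *)
move=> x _; rewrite -EFinM lee_fin mulrCA ler_pM2l ?invr_gt0//.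
apply: invexp_mean_ratio => //.
rewrite (le_trans (ler_distD (q d) _ _))// lerD2l.
exact: q_le.
Qed.
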